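(* Let $B$ be a unital complex Banach algebra. Suppose that an invertible element $b\in B$ is doubly power-bounded, and that $\lambda$ is an isolated point of the spectrum $\sigma(b)$. Then there exists an idempotent $p\in B$ such that \[ bp=\lambda p. \]
   Context: An invertible element $x$ of a unital complex Banach algebra is called doubly power-bounded if $\sup_{n\in\mathbb{Z}}\|x^n\|<\infty$. An idempotent in a Banach algebra is an element $a$ with $a^2=a$. The spectrum $\sigma(b)$ is the spectrum of $b$ in $B$. *)

(* Defs.v *)
From HB Require Import structures.
From mathcomp Require Import all_boot all_order all_algebra.
From mathcomp Require Import complex.
From mathcomp Require Import boolp classical_sets functions reals topology normedtype.

Set Implicit Arguments.
Unset Strict Implicit.
Unset Printing Implicit Defensive.

Import Order.TTheory GRing.Theory Num.Theory.
Import numFieldNormedType.Exports.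

Local Open Scope classical_set_scope.
Local Open Scope ring_scope.
Local Open Scope complex_scope.

(* The norm is a new R-valued operation [bnorm], and not [Num.norm]: in the
   MathComp hierarchy a ring with a [Num.norm] is at least a numDomainType, so
   [NormedModule] cannot be joined with [Algebra]. Submultiplicativity is the
   only condition on the norm of 1. *)
HB.mixin Record UnitAlgebra_isBanach (R : realType) B
    & GRing.UnitAlgebra R[i] B := {
  bnorm : B -> R ;
  bnorm_eq0 : forall x : B, bnorm x = 0 -> x = 0 ;
  bnormD_le : forall x y : B, bnorm (x + y) <= bnorm x + bnorm y ;
  bnormZ : forall (a : R[i]) (x : B), (bnorm (a *: x))%:C = `|a| * (bnorm x)%:C ;
  bnormM_le : forall x y : B, bnorm (x * y) <= bnorm x * bnorm y ;
  bnorm_complete : forall u : nat -> B,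
    (forall e : R, 0 < e -> exists N : nat, forall m n : nat,
       (N <= m)%N -> (N <= n)%N -> bnorm (u m - u n) < e) ->
    exists l : B, forall e : R, 0 < e -> exists N : nat, forall n : nat,
       (N <= n)%N -> bnorm (u n - l) < e
}.

#[short(type="banachAlgType")]
HB.structure Definition BanachAlgebra (R : realType) :=
  {B of GRing.UnitAlgebra R[i] B & UnitAlgebra_isBanach R B}.

Section definitions.
Context {R : realType} {B : banachAlgType R}.

Definition spectrum (b : B) : set R[i] :=
  [set z | z%:A - b \isn't a GRing.unit].

Definition doubly_power_bounded (x : B) : Prop :=
  x \is a GRing.unit /\ has_ubound (range (fun n : int => bnorm (x ^ n))).

(* 0 is idempotent, and satisfies b * 0 = lambda *: 0: a statement that some
   idempotent p satisfies b * p = lambda *: p has content only for p <> 0. *)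
Definition is_idempotent (a : B) : Prop := a * a = a.

End definitions.

(* Main.v *)
Require Import Defs.
From mathcomp Require Import all_boot all_order all_algebra.
From mathcomp Require Import complex ring lra.
From mathcomp Require Import boolp classical_sets functions reals topology normedtype.
From mathcomp Require Import sequences.

(** Put [a = b - lambda]. The proof has two independent halves: the isolated
    spectral point yields an idempotent [p != 0] on which [a] is quasinilpotent,
    and power-boundedness then forces [a * p = 0].

    The idempotent ([riesz_idempotent]). The Riesz projection is the mean of
    [(1 - a / z)^-1] over a small circle [|z| = r]. The mean over the [2 ^ k]
    rotations of [z] by roots of unity is the single inverse
    [F k z = (1 - (a / z) ^+ (2 ^ k))^-1], so contour integrals can be replaced by
    the limit of [F k r]. By compactness the resolvent is bounded on annuli inside
    the punctured disc, hence [F 0] is Lipschitz there, and averaging over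
    rotations gives the same Lipschitz constant to every [F k]. As [F k.+1 z] is
    the mean of [F k z] and [F k (w * z)] with [w] geometrically close to 1, the
    sequence converges; call the limit [P r]. An algebraic identity gives
    [P r * P s = P s] for [s < r]; with the Lipschitz bound this makes [P r]
    idempotent and, since a small idempotent vanishes, independent of [r]. If [P r]
    were 0, some [F k r] would have norm below 1 and [a] would be invertible.
    Finally [F k r * P r --> P r] forces [(a / r) ^+ (2 ^ k) * P r] to be small, so
    the powers of [a] on [P r] decay at every geometric rate.

    Gelfand's theorem at a vector ([local_gelfand]). The spectrum of [b] lies on the
    unit circle, so [c = b / lambda] is doubly power-bounded too. Let
    [S m = c ^ m - c ^ - m], which is [2i sin (m x)] if [c = exp (i x)]. In the norm
    [sup_n |c ^ n v|] each [S m] is an operator of norm at most 2, and the triple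
    angle formula reads [S (3 m) = S m ^+ 3 + 3 S m]. Since [S m] is quasinilpotent
    on [p], this cubic equation can be solved for [S m] by iterating
    [z |-> (S (3 m) - z ^+ 3) / 3] from 0, which shows that a bound [t <= 2] for
    [S (3 m)] implies the bound [t / 2] for [S m]. Climbing through [m], [3 m],
    [9 m], and so on, the norm of [S 1] on [p] is at most [2 / 2 ^ k] for all [k].
    So [(c - c^-1) * p = 0], and quasinilpotence of [c - 1] gives [c * p = p]. *)

Set Implicit Arguments.
Unset Strict Implicit.
Unset Printing Implicit Defensive.

Import Order.TTheory GRing.Theory Num.Theory numFieldNormedType.Exports.
Import ComplexField.Normc.
Local Open Scope classical_set_scope.
Local Open Scope ring_scope.
Local Open Scope complex_scope.

(** * Complex moduli and limits in a Banach algebra *)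

Lemma normcC (R : rcfType) (z : R[i]) : (normc z)%:C = `|z|.
Proof. by rewrite normc_def; case: z. Qed.

Lemma normc_ge0 (R : rcfType) (z : R[i]) : 0 <= normc z.
Proof. by rewrite -lecR normcC normr_ge0. Qed.

Lemma normc_gt0 (R : rcfType) (z : R[i]) : (0 < normc z) = (z != 0).
Proof. by rewrite -ltcR normcC normr_gt0. Qed.

Lemma normcX (R : rcfType) (z : R[i]) n : normc (z ^+ n) = normc z ^+ n.
Proof. by apply: complexI; rewrite rmorphXn /= !normcC normrX. Qed.

Lemma normc_real (R : rcfType) (r : R) : 0 <= r -> normc r%:C = r.
Proof. by move=> r0; rewrite /= expr0n addr0 sqrtr_sqr ger0_norm. Qed.

Section Norm.
Variables (R : realType) (B : banachAlgType R).
Implicit Types (x y z : B) (u v : nat -> B).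

Lemma bnorm_scale (a : R[i]) x : bnorm (a *: x) = normc a * bnorm x.
Proof. by apply: complexI; rewrite bnormZ rmorphM /= normcC. Qed.

Lemma bnorm0 : bnorm (0 : B) = 0.
Proof. by rewrite -(scale0r (0 : B)) bnorm_scale normc0 mul0r. Qed.

Lemma bnormN x : bnorm (- x) = bnorm x.
Proof. by apply: complexI; rewrite -scaleN1r bnormZ normrN1 mul1r. Qed.

Lemma bnorm_ge0 x : 0 <= bnorm x.
Proof. by have := bnormD_le x (- x); rewrite subrr bnorm0 bnormN; lra. Qed.

Lemma bnormB_le x y : bnorm (x - y) <= bnorm x + bnorm y.
Proof. by rewrite -(bnormN y) bnormD_le. Qed.

Lemma bnorm_distC x y : bnorm (x - y) = bnorm (y - x).
Proof. by rewrite -bnormN opprB. Qed.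

Lemma bnorm_dist_trans y x z : bnorm (x - z) <= bnorm (x - y) + bnorm (y - z).
Proof. by have := bnormD_le (x - y) (y - z); rewrite addrA subrK. Qed.

Lemma bnormX_le x n : bnorm (x ^+ n) <= bnorm (1 : B) * bnorm x ^+ n.
Proof.
elim: n => [|n IHn]; first by rewrite !expr0 mulr1.
rewrite !exprSr mulrA (le_trans (bnormM_le _ _))//.
by rewrite ler_wpM2r ?bnorm_ge0.
Qed.

Lemma bnorm_le0 x : bnorm x <= 0 -> x = 0.
Proof. by move=> x0; apply: bnorm_eq0; apply/le_anti; rewrite x0 bnorm_ge0. Qed.

(** [B] carries no topology, so convergence is read off the real sequence of
    distances; this gives access to the limit calculus of [R]. *)
Definition bcvg u x := (fun n => bnorm (u n - x)) @ \oo --> (0 : R).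

Lemma bcvg_squeeze (f : nat -> R) u x :
  (forall n, bnorm (u n - x) <= f n) -> f @ \oo --> (0 : R) -> bcvg u x.
Proof.
move=> uf f0; apply: (@squeeze_cvgr _ _ _ _ (fun=> 0) f) => //.
- by apply: nearW => n; rewrite bnorm_ge0 uf.
- exact: cvg_cst.
Qed.

Lemma bcvg_cst x : bcvg (fun=> x) x.
Proof.
apply: (@bcvg_squeeze (fun=> 0)) => [n|]; first by rewrite subrr bnorm0.
exact: cvg_cst.
Qed.

Lemma bcvgD u v x y : bcvg u x -> bcvg v y -> bcvg (fun n => u n + v n) (x + y).
Proof.
move=> ux vy; apply: (bcvg_squeeze (f := fun n => bnorm (u n - x) + bnorm (v n - y))).
  by move=> n; rewrite opprD addrACA bnormD_le.
by rewrite -[0](addr0 0); apply: cvgD.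
Qed.

Lemma bcvgN u x : bcvg u x -> bcvg (fun n => - u n) (- x).
Proof. by apply: bcvg_squeeze => n; rewrite -opprD bnormN. Qed.

Lemma bcvgB u v x y : bcvg u x -> bcvg v y -> bcvg (fun n => u n - v n) (x - y).
Proof. by move=> ux vy; apply: bcvgD => //; apply: bcvgN. Qed.

Lemma bcvgM u v x y : bcvg u x -> bcvg v y -> bcvg (fun n => u n * v n) (x * y).
Proof.
move=> ux vy.
pose f n := bnorm (u n - x) * bnorm (v n - y) + bnorm (u n - x) * bnorm y
  + bnorm x * bnorm (v n - y).
apply: (bcvg_squeeze (f := f)) => [n|].
  have -> : u n * v n - x * y = (u n - x) * (v n - y) + (u n - x) * y + x * (v n - y).
    by rewrite -mulrDr subrK mulrBl mulrBr addrA subrK.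
  rewrite (le_trans (bnormD_le _ _))// lerD ?bnormM_le//.
  by rewrite (le_trans (bnormD_le _ _))// lerD ?bnormM_le.
rewrite -[0]addr0; apply: cvgD; last first.
  by rewrite -(mulr0 (bnorm x)); apply: cvgM => //; apply: cvg_cst.
rewrite -[0]addr0; apply: cvgD; last first.
  by rewrite -(mul0r (bnorm y)); apply: cvgM => //; apply: cvg_cst.
by rewrite -(mul0r 0); apply: cvgM.
Qed.

Lemma bcvg_le u x A : (forall n, bnorm (u n) <= A) -> bcvg u x -> bnorm x <= A.
Proof.
move=> uA ux.
have h : (fun n => A + bnorm (u n - x)) @ \oo --> A.
  by rewrite -[X in _ --> X]addr0; apply: cvgD => //; apply: cvg_cst.
rewrite -(cvg_lim (@Rhausdorff R) h); apply: limr_ge; first by apply: cvgP h.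
apply: nearW => n; have := bnorm_dist_trans (u n) x 0.
by rewrite !subr0 (bnorm_distC x); have := uA n; lra.
Qed.

Lemma bcvg_unique u x y : bcvg u x -> bcvg u y -> x = y.
Proof.
move=> ux uy; apply/eqP; rewrite -subr_eq0; apply/eqP/bnorm_le0.
apply: bcvg_le (bcvgB ux uy) => n.
by rewrite subrr bnorm0.
Qed.

Lemma bcvg_small u x e : 0 < e -> bcvg u x -> exists n, bnorm (u n - x) < e.
Proof.
move=> e0 /cvgrPdist_lt /(_ e e0) [N _ /(_ N (leqnn N))].
by rewrite sub0r normrN ger0_norm ?bnorm_ge0// => h; exists N.
Qed.

(** The only place where completeness of [B] enters. *)
Lemma bcvg_geometric u A r : 0 <= r < 1 ->
  (forall n, bnorm (u n.+1 - u n) <= A * r ^+ n) -> exists x, bcvg u x.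
Proof.
move=> /andP[r0 r1] ur.
have s0 : 0 < 1 - r by rewrite subr_gt0.
have A0 : 0 <= A by have := ur 0%N; rewrite expr0 mulr1; apply/le_trans/bnorm_ge0.
have tail n d : bnorm (u (n + d)%N - u n) <= A / (1 - r) * r ^+ n.
  suff : bnorm (u (n + d)%N - u n) <= A / (1 - r) * r ^+ n * (1 - r ^+ d).
    move/le_trans; apply; rewrite ler_piMr ?mulr_ge0 ?invr_ge0 ?exprn_ge0 ?(ltW s0)//.
    by rewrite gerBl exprn_ge0.
  elim: d => [|d IHd]; first by rewrite addn0 subrr bnorm0 expr0 subrr mulr0.
  rewrite addnS (le_trans (bnorm_dist_trans (u (n + d)%N) _ _))//.
  rewrite (le_trans (lerD (ur _) IHd))// le_eqVlt; apply/orP; left; apply/eqP.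
  by rewrite exprD exprS; field; rewrite gt_eqF.
pose K := A / (1 - r).
have K0 : 0 <= K by rewrite mulr_ge0 ?invr_ge0 ?(ltW s0).
have gK : (fun n => K * r ^+ n) @ \oo --> (0 : R).
  by apply: cvg_geometric; rewrite ger0_norm.
suff /bnorm_complete[x hx] : forall e : R, 0 < e -> exists N : nat, forall m n : nat,
    (N <= m)%N -> (N <= n)%N -> bnorm (u m - u n) < e.
  exists x; apply/cvgrPdist_lt => e /hx[N hN]; exists N => // n /hN.
  by rewrite sub0r normrN ger0_norm ?bnorm_ge0.
move=> e e0; have /cvgrPdist_lt /(_ (e / 2)) := gK.
case; first by rewrite divr_gt0.
move=> N _ /(_ N (leqnn N)); rewrite sub0r normrN ger0_norm ?(mulr_ge0 K0 (exprn_ge0 _ r0))//.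
move=> KN; exists N => m n /subnKC <- /subnKC <-.
have := bnorm_dist_trans (u N) (u (N + (m - N))%N) (u (N + (n - N))%N).
have := tail N (m - N)%N; have := tail N (n - N)%N.
rewrite (bnorm_distC (u N) (u (N + (n - N))%N)).
by move: KN; rewrite /K; lra.
Qed.

Lemma cvg_geom (A r : R) : 0 <= r < 1 -> (fun n => A * r ^+ n) @ \oo --> (0 : R).
Proof. by move=> /andP[r0 r1]; apply: cvg_geometric; rewrite ger0_norm. Qed.

(** The Neumann series converges. The hypothesis bears on the powers of [x] rather
    than on [bnorm x]: for [x] a multiple of a power-bounded element only the
    former is available. *)
Lemma neumann_unit x A r : 0 <= r < 1 ->
  (forall n, bnorm (x ^+ n) <= A * r ^+ n) -> 1 - x \is a GRing.unit.
Proof.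
move=> r01 xr; pose S n := \sum_(i < n) x ^+ i.
have /(bcvg_geometric r01)[y Sy] n : bnorm (S n.+1 - S n) <= A * r ^+ n.
  by rewrite /S big_ord_recr /= addrAC subrr add0r.
have x0 : bcvg (fun n => 1 - x ^+ n) 1.
  apply: (bcvg_squeeze (f := fun n => A * r ^+ n)); last exact: cvg_geom.
  by move=> n; rewrite addrAC subrr add0r bnormN.
have comS n : GRing.comm (1 - x) (S n).
  by apply: commr_sum => i _; apply/commr_sym/commrB;
    [apply: commr1|apply/commr_sym/commrX/commr_refl].
have E n : (1 - x) * S n = 1 - x ^+ n by rewrite -opprB mulNr -subrX1 opprB.
apply/unitrP; exists y; split; apply: (@bcvg_unique (fun n => 1 - x ^+ n)) => //.
- have -> : (fun n => 1 - x ^+ n) = (fun n => S n * (1 - x)).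
    by apply/funext => n; rewrite -comS E.
  by apply: bcvgM => //; apply: bcvg_cst.
- have -> : (fun n => 1 - x ^+ n) = (fun n => (1 - x) * S n).
    by apply/funext => n; rewrite E.
  by apply: bcvgM => //; apply: bcvg_cst.
Qed.

Lemma bnorm_lt1_unit x : bnorm x < 1 -> 1 - x \is a GRing.unit.
Proof. by move=> x1; apply: neumann_unit (bnormX_le x); rewrite bnorm_ge0. Qed.

End Norm.

(** * Quasinilpotent vectors of a doubly power-bounded element *)

Section LocalGelfand.
Variables (R : realType) (B : banachAlgType R) (c : B) (M : R).
Hypothesis cU : c \is a GRing.unit.
Hypothesis cM : forall n : int, bnorm (c ^ n) <= M.
Implicit Types (v w x y z : B) (C t : R).

(** Quasinilpotence is asked at one vector [v] of the left regular module only, so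
    that for [v = p] it speaks of the corner algebra of an idempotent [p] without
    that algebra being formed. *)
Definition quasinilp_at v := forall e : R, 0 < e ->
  exists C, forall k, bnorm ((c - 1) ^+ k * v) <= C * e ^+ k.

(** [orbit_le C v] bounds by [C] the equivalent norm [sup_n |c ^ n v|], for which [c]
    is an isometry. *)
Definition orbit_le C v := forall n : int, bnorm (c ^ n * v) <= C.

(** The operator norm of [w], for the norm above, on the space of quasinilpotent
    vectors. Commutation with [c] makes that space stable under [w]. *)
Definition op_le t w := GRing.comm w c /\
  forall v C, quasinilp_at v -> orbit_le C v -> orbit_le (t * C) (w * v).

Lemma bound_ge0 : 0 <= M.
Proof. exact: le_trans (bnorm_ge0 _) (cM 0). Qed.

Lemma comm_sub1 w k : GRing.comm w c -> w * (c - 1) ^+ k = (c - 1) ^+ k * w.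
Proof. by move=> wc; apply/commrX/commrB => //; apply: commr1. Qed.

Lemma quasinilp_atM w v : GRing.comm w c -> quasinilp_at v -> quasinilp_at (w * v).
Proof.
move=> wc qv e /qv[C vC]; exists (bnorm w * C) => k.
rewrite mulrA -comm_sub1// -mulrA (le_trans (bnormM_le _ _))// -mulrA.
by rewrite ler_wpM2l ?bnorm_ge0.
Qed.

Lemma orbit_le_M C v : bnorm v <= C -> orbit_le (M * C) v.
Proof.
move=> vC n; rewrite (le_trans (bnormM_le _ _))//.
by rewrite ler_pM ?bnorm_ge0.
Qed.

Lemma orbit_le_bnorm C v : orbit_le C v -> bnorm v <= C.
Proof. by move=> /(_ 0); rewrite expr0z mul1r. Qed.

Lemma orbit_le_ge0 C v : orbit_le C v -> 0 <= C.
Proof. by move/orbit_le_bnorm; apply/le_trans/bnorm_ge0. Qed.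

Lemma orbit_leD C D v w : orbit_le C v -> orbit_le D w -> orbit_le (C + D) (v + w).
Proof. by move=> vC wD n; rewrite mulrDr (le_trans (bnormD_le _ _))// lerD. Qed.

Lemma orbit_leZ C (a : R[i]) v : orbit_le C v -> orbit_le (normc a * C) (a *: v).
Proof.
by move=> vC n; rewrite -scalerAr bnorm_scale ler_wpM2l ?normc_ge0.
Qed.

Lemma orbit_leW C D v : C <= D -> orbit_le C v -> orbit_le D v.
Proof. by move=> CD vC n; apply: le_trans CD. Qed.

Lemma op_leW s t w : s <= t -> op_le s w -> op_le t w.
Proof.
move=> st [wc ws]; split=> // v C qv vC.
by apply: orbit_leW (ws v C qv vC); rewrite ler_wpM2r ?(orbit_le_ge0 vC).
Qed.

Lemma op_le0 : op_le 0 0.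
Proof.
split; first exact/commr_sym/commr0.
by move=> v C _ _ n; rewrite mul0r mulr0 bnorm0 mul0r.
Qed.

Lemma op_leXz (n : int) : op_le 1 (c ^ n).
Proof.
split; first exact/commr_sym/commrXz.
by move=> v C _ vC m; rewrite mulrA -exprzDr // mul1r.
Qed.

Lemma op_leD s t w x : op_le s w -> op_le t x -> op_le (s + t) (w + x).
Proof.
move=> [wc ws] [xc xt]; split; first exact/commr_sym/commrD/commr_sym/xc/commr_sym.
by move=> v C qv vC; rewrite !mulrDl; apply: orbit_leD; [exact: ws|exact: xt].
Qed.

Lemma op_leZ t (a : R[i]) w : op_le t w -> op_le (normc a * t) (a *: w).
Proof.
move=> [wc wt]; split.
  by rewrite /GRing.comm -scalerAl -scalerAr wc.
by move=> v C qv vC; rewrite -(mulrA (normc a)) -(scalerAl a); apply: orbit_leZ; apply: wt.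
Qed.

Lemma op_leN t w : op_le t w -> op_le t (- w).
Proof. by move=> /(op_leZ (-1)); rewrite normcN normc1 mul1r scaleN1r. Qed.

Lemma op_leM s t w x : op_le s w -> op_le t x -> op_le (s * t) (w * x).
Proof.
move=> [wc ws] [xc xt]; split; first exact/commr_sym/commrM/commr_sym/xc/commr_sym.
move=> v C qv vC; rewrite -(mulrA s) -(mulrA w); apply: ws; first exact: quasinilp_atM.
exact: xt.
Qed.

(** This is [2i sin (m x)] when [c = exp (i x)]. *)
Definition sine m := c ^ (m : int) - c ^ (- m).

Lemma sine_op_le m : op_le 2 (sine m).
Proof. by apply: op_leD; [|apply: op_leN]; apply: op_leXz. Qed.

Lemma triple_sine m : sine (3 * m) = sine m ^+ 3 + 3 *: sine m.
Proof.
rewrite /sine; have -> : (3 * m = m + m + m)%R by ring.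
rewrite !opprD !exprzDr//.
set x := c ^ m; set y := c ^ (- m).
have xy : x * y = 1 by rewrite -exprzDr// subrr expr0z.
have yx : y * x = 1 by rewrite -exprzDr// addNr expr0z.
have sq : (x - y) ^+ 2 + 3%:A = x * x + 1 + y * y.
  have -> : 3%:A = 1 + 1 + 1 :> B by rewrite scaler_nat !mulrSr mulr0n add0r.
  rewrite expr2 mulrBl !mulrBr xy yx opprB addrA.
  by rewrite [x * x - 1 + _]addrACA -(opprD 1 1) subrK addrAC.
rewrite exprS -[3 *: (x - y)]mulr1 -scalerAl scalerAr -mulrDr sq.
rewrite mulrBl !mulrDr !mulr1 !mulrA xy yx !mul1r.
by rewrite opprD addrA -(addrA _ x y) addrK.
Qed.

(** [sine m] is a multiple of [c - 1] by an element commuting with [c], so its powers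
    at [v] also decay faster than any geometric sequence. Rate [1 / 2] is all that
    [op_le_halve] uses. *)
Lemma quasinilp_sine m v : quasinilp_at v ->
  exists C, forall k, bnorm (sine m%:Z ^+ k * v) <= C * 2^-1 ^+ k.
Proof.
move=> qv.
pose h := (\sum_(i < m + m) c ^+ i) * c ^ (- m%:Z).
have cc n : GRing.comm c (c ^ n) by apply/commrXz.
have hc : GRing.comm h c.
  apply/commr_sym/commrM => //; apply: commr_sum => i _; exact/commrX/commr_refl.
have -> : sine m = (c - 1) * h.
  rewrite /h mulrA -subrX1 mulrBl mul1r /sine; congr (_ - _).
  by rewrite exprnP -exprzDr// PoszD addrK.
have h0 : 0 < bnorm h + 1 by rewrite ltr_wpDl ?bnorm_ge0.
have [|C hC] := qv (2 * (bnorm h + 1))^-1; first by rewrite invr_gt0 mulr_gt0.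
exists (bnorm (1 : B) * C) => k.
have C0 : 0 <= C by have := hC 0%N; rewrite expr0 mulr1; apply/le_trans/bnorm_ge0.
rewrite exprMn_comm; last exact/commr_sym/commrB/commr1.
rewrite -comm_sub1; last by apply/commr_sym/commrX/commr_sym.
rewrite -(mulrA (h ^+ k)) (le_trans (bnormM_le _ _))//.
apply: (le_trans (ler_pM (bnorm_ge0 _) (bnorm_ge0 _) (bnormX_le _ _) (hC k))).
rewrite invfM exprMn.
set r := 2^-1 ^+ k; have r0 : 0 <= r by rewrite exprn_ge0 ?invr_ge0.
have hk : bnorm h ^+ k * (bnorm h + 1)^-1 ^+ k <= 1.
  rewrite -exprMn exprn_ile1 ?mulr_ge0 ?invr_ge0 ?bnorm_ge0 ?(ltW h0)//.
  by rewrite ler_pdivrMr// mul1r lerDl.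
rewrite [leLHS](_ : _ = bnorm (1 : B) * C * r * (bnorm h ^+ k * (bnorm h + 1)^-1 ^+ k)).
  by rewrite ler_piMr// !mulr_ge0 ?bnorm_ge0.
by ring.
Qed.

(** A small solution [y] of [y ^+ 3 + 3 y = s] is the limit of the iterates [z] of
    [z |-> (s - z ^+ 3) / 3] started at 0. For [t <= 2] the ball of radius [t / 2]
    is stable, because [(t + (t / 2) ^+ 3) / 3 <= t / 2]. The iterates do approach
    [y]: the factor between successive errors is [(y ^+ 2 + z y + z ^+ 2) / 3],
    where [y] counts as [1 / 2] and [z] as [1], that is [7 / 12] in total. Without
    smallness of [y] the iterates could converge to another root. *)
Lemma op_le_halve t s y :
  GRing.comm y c -> 0 <= t <= 2 -> op_le t s -> GRing.comm s y ->
  s = y ^+ 3 + 3 *: y ->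
  (forall v, quasinilp_at v -> exists C, forall k, bnorm (y ^+ k * v) <= C * 2^-1 ^+ k) ->
  op_le (t / 2) y.
Proof.
move=> yc /andP[t0 t2] st sy sE yq.
pose z := fix z n := if n is n.+1 then 3^-1 *: (s - z n ^+ 3) else 0.
have n3 : normc (3^-1 : R[i]) = 3^-1.
  rewrite -[3^-1]/((3%:R : R[i])^-1) -(rmorph_nat (real_complex R)) -fmorphV.
  by rewrite normc_real ?invr_ge0.
have zt n : op_le (t / 2) (z n).
  elim: n => [|n IHn]; first by apply: op_leW op_le0; rewrite divr_ge0.
  apply: (@op_leW (normc (3^-1 : R[i]) * (t + (t / 2) * (t / 2) * (t / 2)))).
    rewrite n3.
    have : t * t <= 4 by nra.
    have -> : t / 2 = (2^-1 * t) by rewrite mulrC.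
    by nra.
  apply/op_leZ/op_leD => //; apply: op_leN.
  by rewrite !exprSr expr0 mul1r; do 2![apply: op_leM => //].
have zy n : GRing.comm y (z n).
  elim: n => [|n IHn] /=; first exact: commr0.
  rewrite /GRing.comm -scalerAl -scalerAr; congr (_ *: _).
  by apply: commrB; [apply/commr_sym|apply: commrX].
split=> // v C qv vC.
have [D hD] := yq v qv.
have D0 : 0 <= D by have := hD 0%N; rewrite expr0 mulr1; apply/le_trans/bnorm_ge0.
have z1 n : op_le 1 (z n) by apply: op_leW (zt n); lra.
(* The powers of [y] are carried along in the induction hypothesis, because the
   decay of [y] is only known on iterated powers and not in operator norm. *)
have key j k : orbit_le (M * (D * 2^-1 ^+ k) * (7 / 12) ^+ j) ((y - z j) * (y ^+ k * v)).
  elim: j k => [|j IHj] k.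
    rewrite subr0 expr0 mulr1 (mulrA y) -exprS.
    apply: orbit_leW (orbit_le_M (hD k.+1)); rewrite ler_wpM2l ?bound_ge0// ler_wpM2l//.
    by rewrite exprS ler_piMl ?exprn_ge0 ?invr_ge0// invf_le1 ?ler1n.
  have yzE : y - z j.+1 = (- 3^-1) *: ((y - z j) * (y ^+ 2 + z j * y + z j ^+ 2)).
    have -> : (y - z j) * (y ^+ 2 + z j * y + z j ^+ 2) = y ^+ 3 - z j ^+ 3.
      rewrite (subrXX_comm 3 (zy j)) !big_ord_recr big_ord0 /= add0r.
      by rewrite !expr0 !expr1 mulr1 mul1r (zy j).
    rewrite /= sE addrAC scalerDr scalerA mulVf ?pnatr_eq0// scale1r.
    by rewrite opprD addrCA subrr addr0 scaleNr.
  have qk i : quasinilp_at ((y - z j) * (y ^+ i * v)).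
    apply: quasinilp_atM; last first.
      by apply: quasinilp_atM => //; apply/commr_sym/commrX/commr_sym.
    by apply/commr_sym/commrB/commr_sym; [apply/commr_sym|case: (zt j)].
  have -> : (y - z j.+1) * (y ^+ k * v) = (- 3^-1) *: ((y - z j) * (y ^+ k.+2 * v)
      + z j * ((y - z j) * (y ^+ k.+1 * v)) + z j * (z j * ((y - z j) * (y ^+ k * v)))).
    have zc : (y - z j) * z j = z j * (y - z j).
      by apply/commr_sym/commrB/commr_refl/commr_sym.
    rewrite yzE -scalerAl; congr (_ *: _).
    rewrite !(exprS y k.+1) !(exprS y k) -!(mulrA y).
    move: (y - z j) (y ^+ k * v) zc => D' X zc.
    rewrite !mulrDr !mulrDl !expr2 !mulrA !zc.
    by rewrite -[in LHS](mulrA (z j) D' (z j)) zc !mulrA.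
  have o1 := (z1 j).2 _ _ (qk k.+1) (IHj k.+1).
  have o0 := (z1 j).2 _ _ (quasinilp_atM (zt j).1 (qk k)) ((z1 j).2 _ _ (qk k) (IHj k)).
  apply: orbit_leW (orbit_leZ _ (orbit_leD (orbit_leD (IHj k.+2) o1) o0)).
  rewrite normcN n3 !mul1r !exprS le_eqVlt; apply/orP; left; apply/eqP.
  by field.
have lim n : bcvg (fun j => c ^ n * (z j * v)) (c ^ n * (y * v)).
  apply: (@bcvg_squeeze _ _ (fun j => (M * D) * (7 / 12) ^+ j)); last first.
    by apply: cvg_geom; lra.
  move=> j; rewrite bnorm_distC -mulrBr -mulrBl; have := key j 0%N n.
  by rewrite expr0 mul1r mulr1.
by move=> n; apply: bcvg_le (lim n) => j; apply: (zt j).2.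
Qed.

Lemma sine_op_le_exp2 k m : op_le (2 * 2^-1 ^+ k) (sine m%:Z).
Proof.
elim: k m => [|k IHk] m; first by rewrite expr0 mulr1; apply: sine_op_le.
rewrite exprSr mulrA; apply: (@op_le_halve _ (sine (3 * m%:Z))).
- exact: (sine_op_le m).1.
- rewrite mulr_ge0 ?exprn_ge0 ?invr_ge0//= ler_piMr//.
  by rewrite exprn_ile1 ?invr_ge0// invf_le1 ?ler1n.
- exact: (IHk (3 * m)%N).
- have sc i j : GRing.comm (c ^ i) (c ^ j) by rewrite /GRing.comm -!exprzDr// addrC.
  apply: commrB; apply/commr_sym/commrB; exact: sc.
- exact: triple_sine.
- exact: quasinilp_sine.
Qed.

(** The local form of Gelfand's theorem that a doubly power-bounded element with
    spectrum [{1}] is the identity. *)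
Theorem local_gelfand v : quasinilp_at v -> c * v = v.
Proof.
move=> qv; pose w := (c - 1) * v.
have s0 : sine 1 * v = 0.
  apply: bnorm_le0; pose A := 2 * (M * bnorm v).
  apply: (@bcvg_le _ _ (fun n => sine 1 * v) _ 0) (bcvg_cst _) => _.
  apply/ler_addgt0Pl => e e0; rewrite addr0.
  have /cvgrPdist_lt /(_ e e0) [N _ /(_ N (leqnn N))] := cvg_geom A (r := 2^-1) ltac:(lra).
  rewrite sub0r normrN => /ltW; apply: le_trans; apply: le_trans (ler_norm _).
  have := (sine_op_le_exp2 N 1).2 _ _ qv (orbit_le_M (lexx (bnorm v))).
  by move/orbit_le_bnorm; rewrite /A mulrAC.
(* Since [c ^+ 2 * v = v], the vector [w] is an eigenvector of [c - 1] for the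
   eigenvalue [-2]; quasinilpotence excludes this unless [w = 0]. *)
have cw : (c - 1) * w = (- 2) *: w.
  have : (c - 1) * (c - 1) * v + 2 *: w = 0.
    have -> : 2 *: w = (c - 1) * (1 + 1) * v.
      by rewrite scaler_nat mulrDr mulr1 mulrDl mulr2n.
    rewrite -mulrDl -mulrDr addrA subrK mulrBl mul1r mulrDr mulr1 opprD addrA addrK.
    have -> : c * c - 1 = c * sine 1 by rewrite /sine expr1z mulrBr divrr.
    by rewrite -mulrA s0 mulr0.
  by move/eqP; rewrite addr_eq0 -scaleNr -mulrA => /eqP.
have cwk k : (c - 1) ^+ k * w = (- 2) ^+ k *: w.
  elim: k => [|k IHk]; first by rewrite !expr0 mul1r scale1r.
  by rewrite exprSr -mulrA cw -scalerAr IHk scalerA -exprS.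
have w0 : w = 0.
  have [C hC] := qv 1 ltr01.
  apply: bnorm_le0; apply: (bcvg_le (u := fun=> w)) (bcvg_cst w) => _.
  apply/ler_addgt0Pl => e e0; rewrite addr0.
  have /cvgrPdist_lt /(_ e e0) [N _ /(_ N (leqnn N))] := cvg_geom C (r := 2^-1) ltac:(lra).
  rewrite sub0r normrN => /ltW; apply: le_trans; apply: le_trans (ler_norm _).
  have := hC N.+1; rewrite exprSr -mulrA -/w cwk bnorm_scale expr1n mulr1.
  rewrite normcX normcN -(rmorph_nat (real_complex R)) normc_real ?ler0n//.
  by rewrite exprVn ler_pdivlMr ?exprn_gt0 // mulrC.
by apply/eqP; rewrite -subr_eq0 -{2}(mul1r v) -mulrBl; apply/eqP.
Qed.

End LocalGelfand.

(** * Dyadic roots of -1 *)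

Lemma dyadic_root_norm (R : rcfType) (w : R[i]) k : w ^+ (2 ^ k) = -1 -> normc w = 1.
Proof.
move=> wk; have : normc w ^+ (2 ^ k) == 1 by rewrite -normcX wk normcN normc1.
by rewrite pexprn_eq1 ?normc_ge0// expn_eq0 /= => /eqP.
Qed.

(** Roots near 1 are obtained by iterating the square root with nonnegative real
    part: then [|w + 1| >= sqrt 2 >= 4 / 3], and [w ^+ 2 - 1] factors. *)
Lemma dyadic_root (R : rcfType) k :
  exists z : R[i], z ^+ (2 ^ k) = -1 /\ normc (z - 1) <= 2 * (3 / 4) ^+ k.
Proof.
elim: k => [|k [z [zk z1]]].
  exists (-1); rewrite expn0 expr1; split=> //.
  rewrite -opprD normcN -[1 + 1]/(2%:R) -(rmorph_nat (real_complex R)).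
  by rewrite normc_real// expr0 mulr1.
exists (sqrtc z); split; first by rewrite expnS exprM sqr_sqrtc.
set w := sqrtc z.
have w2 : w ^+ 2 = z := sqr_sqrtc z.
have Nz := dyadic_root_norm zk.
have Nw : normc w ^+ 2 = 1 by rewrite -normcX w2.
have Rw : 0 <= complex.Re w by rewrite /w; case: (z) => x y; rewrite /= sqrtr_ge0.
have w43 : 4 / 3 <= normc (w + 1).
  rewrite -(@ler_pXn2r _ 2) ?nnegrE ?normc_ge0 ?divr_ge0//.
  move: Nw Rw; case: (w) => x y.
  rewrite /= !sqr_sqrtr ?addr_ge0 ?sqr_ge0// addr0; nra.
have : normc (z - 1) = normc (w - 1) * normc (w + 1).
  by rewrite -normcM -w2 -subr_sqr_1.
rewrite exprSr; have := normc_ge0 (w - 1); nra.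
Qed.

(** * The resolvent on an annulus *)

Section Resolvent.
Variables (R : realType) (B : banachAlgType R) (a : B).
Implicit Types (z w : R[i]).

Definition resolv z := (z%:A - a)^-1.

Lemma resolvB z w : z%:A - a \is a GRing.unit -> w%:A - a \is a GRing.unit ->
  resolv z - resolv w = (w - z) *: (resolv z * resolv w).
Proof.
move=> zU wU.
have -> : (w - z) *: (resolv z * resolv w) = resolv z * ((w%:A - a) - (z%:A - a)) * resolv w.
  by rewrite opprB addrA subrK -scalerBl -scalerAr mulr1 -scalerAl.
by rewrite mulrBr (mulVr zU) mulrBl mul1r -(mulrA (resolv z)) (divrr wU) mulr1.
Qed.

(** Locally, the resolvent identity alone bounds the resolvent at [z] by twice its
    value at a nearby point; compactness of the annulus makes this global. *)
Lemma resolv_bounded r1 r2 : 0 < r1 <= r2 ->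
  (forall z, r1 <= normc z <= r2 -> z%:A - a \is a GRing.unit) ->
  exists K : R, forall z, r1 <= normc z <= r2 -> bnorm (resolv z) <= K.
Proof.
move=> /andP[r10 r12] aU.
have r20 : 0 < r2 by apply: lt_le_trans r12.
pose zz (p : R * R) : R[i] := p.1 +i* p.2.
pose ann := [set p : R * R | r1 <= normc (zz p) <= r2].
have annc : compact ann.
  have pc : continuous (fun p : R * R => p.1 ^+ 2 + p.2 ^+ 2).
    move=> p; rewrite (_ : (fun _ => _) = (fun q => q.1 * q.1 + q.2 * q.2)).
      by apply: cvgD; apply: cvgM; (exact: cvg_fst || exact: cvg_snd).
    by apply/funext => q; rewrite !expr2.
  have annE : ann = (fun p : R * R => p.1 ^+ 2 + p.2 ^+ 2) @^-1` `[r1 ^+ 2, r2 ^+ 2].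
    have nE x y : (r1 <= normc (x +i* y) <= r2) = (r1 ^+ 2 <= x ^+ 2 + y ^+ 2 <= r2 ^+ 2).
      have -> : x ^+ 2 + y ^+ 2 = normc (x +i* y) ^+ 2.
        by rewrite /= sqr_sqrtr ?addr_ge0 ?sqr_ge0.
      by rewrite !ler_pXn2r ?nnegrE ?normc_ge0 ?(ltW r10) ?(ltW r20).
    by apply/seteqP; split => p; rewrite /ann /zz/= in_itv /= -nE.
  apply: (@subclosed_compact _ _ (`[- r2, r2] `*` `[- r2, r2])).
  - rewrite annE; exact: preimage_closed (fun p _ => pc p) (@itv_closed _ _ _ _).
  - by apply: compact_setX; apply: segment_compact.
  - move=> [x y]; rewrite annE /= !in_itv /= => /andP[_ h].
    by split; apply/andP; nra.
have /compact_near_coveringP/near_covering_withinP := annc.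
move=> /(_ nat \oo (fun n p => bnorm (resolv (zz p)) <= n%:R)) H.
have {H}/filter_ex[n hn] : \forall n \near \oo,
    ann `<=` (fun p => bnorm (resolv (zz p)) <= n%:R).
  apply: H => p annp.
  pose K0 := bnorm (resolv (zz p)).
  have K00 : 0 <= K0 by apply: bnorm_ge0.
  (* With this radius [|zz p - zz q| * K0 <= 1 / 2], so that the resolvent
     identity can be solved for the norm at [q]. *)
  pose e := (4 * (K0 + 1))^-1.
  have e0 : 0 < e by rewrite invr_gt0 mulr_gt0// ltr_wpDl.
  have [N hN] : exists N : nat, 2 * K0 <= N%:R.
    by exists (Num.bound (2 * K0)); rewrite ltW// archi_boundP// mulr_ge0.
  exists (ball p e, [set n | (N <= n)%N]) => /=.
    by split; [exact: nbhsx_ballx|exists N].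
  move=> [q n] /= [[pq1 pq2] Nn] annq.
  have := resolvB (aU _ annq) (aU _ annp).
  have := bnorm_dist_trans (resolv (zz p)) (resolv (zz q)) 0.
  rewrite !subr0 => h /(congr1 bnorm); rewrite bnorm_scale => E.
  have hz : normc (zz p - zz q) <= 2 * e.
    rewrite -(@ler_pXn2r _ 2) ?nnegrE ?normc_ge0 ?mulr_ge0 ?(ltW e0)//.
    move: pq1 pq2; rewrite /ball/= !ltr_norml => /andP[? ?] /andP[? ?].
    rewrite /zz /= sqr_sqrtr ?addr_ge0 ?sqr_ge0//; nra.
  have := bnormM_le (resolv (zz q)) (resolv (zz p)); rewrite -/K0 => hm.
  rewrite E in h.
  have eK : e * K0 <= 4^-1.
    rewrite /e invfM -mulrA ler_piMr ?invr_ge0// mulrC ler_pdivrMr ?ltr_wpDl//.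
    by rewrite mul1r lerDl.
  have := ler_pM (normc_ge0 _) (bnorm_ge0 _) hz hm.
  have T0 := bnorm_ge0 (resolv (zz q)).
  have nN : N%:R <= n%:R :> R by rewrite ler_nat.
  move: h; rewrite -/K0; set T := bnorm (resolv (zz q)) in T0 *.
  by move=> h1 h2; nra.
exists n%:R => z hz; have := hn (complex.Re z, complex.Im z).
by rewrite /ann /zz /=; case: z hz => x y /= hz; apply.
Qed.

(** The mean of [(1 - a / (w * z))^-1] over the [2 ^ k]-th roots of unity [w]. *)
Definition dyadic_resolv k z := (1 - (z^-1 *: a) ^+ (2 ^ k))^-1.

Lemma dyadic_rotate z w k : w ^+ (2 ^ k) = -1 ->
  ((w * z)^-1 *: a) ^+ (2 ^ k) = - (z^-1 *: a) ^+ (2 ^ k).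
Proof. by move=> wk; rewrite invfM -scalerA exprZn exprVn wk invrN1 scaleN1r. Qed.

Lemma dyadic_unit_split z w k : w ^+ (2 ^ k) = -1 ->
  1 - (z^-1 *: a) ^+ (2 ^ k.+1) =
  (1 - (z^-1 *: a) ^+ (2 ^ k)) * (1 - ((w * z)^-1 *: a) ^+ (2 ^ k)).
Proof.
move=> wk; rewrite (dyadic_rotate z wk).
by rewrite opprK expnSr exprM mulrDr mulr1 mulrBl mul1r addrA subrK expr2.
Qed.

(** Any rotation-invariant subset of the resolvent set; annuli and punctured discs
    are the instances. *)
Variable D : R[i] -> Prop.
Hypothesis D0 : forall z, D z -> z != 0.
Hypothesis DU : forall z, D z -> z%:A - a \is a GRing.unit.
Hypothesis Drot : forall z w, normc w = 1 -> D z -> D (w * z).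

Lemma dyadic_unit k z : D z -> 1 - (z^-1 *: a) ^+ (2 ^ k) \is a GRing.unit.
Proof.
elim: k z => [|k IHk] z Dz.
  rewrite expr1 -(@scaler_unit _ _ z) ?unitfE ?D0// scalerBr scalerA mulfV ?D0//.
  by rewrite scale1r DU.
have [w [wk _]] := dyadic_root R k.
rewrite (dyadic_unit_split z wk) unitrMl ?IHk//.
by apply/Drot/Dz/(dyadic_root_norm wk).
Qed.

(** The partial fraction [(1 - u ^+ 2)^-1 = ((1 - u)^-1 + (1 + u)^-1) / 2]. *)
Lemma dyadic_resolv_double k z w : w ^+ (2 ^ k) = -1 -> D z ->
  dyadic_resolv k.+1 z = 2^-1 *: (dyadic_resolv k z + dyadic_resolv k (w * z)).
Proof.
move=> wk Dz; have Dwz : D (w * z) by apply/Drot/Dz/(dyadic_root_norm wk).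
rewrite /dyadic_resolv; apply: (mulrI (dyadic_unit k.+1 Dz)).
rewrite divrr ?dyadic_unit// -scalerAr (dyadic_unit_split z wk).
have := dyadic_unit k Dz; have := dyadic_unit k Dwz.
rewrite (dyadic_rotate z wk) opprK.
set u := _ ^+ _ => uU vU.
have uC : (1 - u) * (1 + u) = (1 + u) * (1 - u).
  apply: commrD; first exact: commr1.
  by apply/commr_sym/commrB; [exact: commr1|exact: commr_refl].
rewrite mulrDr {1}uC -!mulrA !divrr// !mulr1.
have -> : 1 + u + (1 - u) = 2%:A by rewrite addrACA subrr addr0 scaler_nat.
by rewrite scalerA mulVf ?scale1r ?pnatr_eq0.
Qed.

(** Rotations preserve distances, and means preserve Lipschitz constants. *)
Lemma dyadic_resolv_lip L : (forall z w, D z -> D w ->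
    bnorm (dyadic_resolv 0 z - dyadic_resolv 0 w) <= L * normc (z - w)) ->
  forall k z w, D z -> D w ->
    bnorm (dyadic_resolv k z - dyadic_resolv k w) <= L * normc (z - w).
Proof.
move=> L0; elim=> // k IHk z w Dz Dw.
have [x [xk _]] := dyadic_root R k.
have x1 := dyadic_root_norm xk.
rewrite !(dyadic_resolv_double xk)// -scalerBr opprD addrACA bnorm_scale.
have -> : normc (2^-1 : R[i]) = 2^-1.
  rewrite normcV -(rmorph_nat (real_complex R)) normc_real ?ler0n//.
have := IHk z w Dz Dw; have := IHk _ _ (Drot x1 Dz) (Drot x1 Dw).
rewrite -mulrBr normcM x1 mul1r.
have := bnormD_le (dyadic_resolv k z - dyadic_resolv k w)
  (dyadic_resolv k (x * z) - dyadic_resolv k (x * w)).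
lra.
Qed.

End Resolvent.

(** * The Riesz idempotent of an isolated spectral point *)

Section Riesz.
Variables (R : realType) (B : banachAlgType R) (a : B) (d : R).
Hypothesis aU : forall z, 0 < normc z < d -> z%:A - a \is a GRing.unit.
Implicit Types (z w : R[i]) (r s : R) (k : nat).
Local Notation F := (dyadic_resolv a).

Lemma dyadic_resolv0 z : z != 0 -> z%:A - a \is a GRing.unit ->
  F 0 z = 1 + a * resolv a z.
Proof.
move=> z0 zU; have -> : 1 + a * resolv a z = z *: resolv a z.
  rewrite -[1](divrr zU) -mulrDl subrK.
  by rewrite -scalerAl mul1r.
rewrite /dyadic_resolv expr1.
have -> : 1 - z^-1 *: a = z^-1 *: (z%:A - a).
  by rewrite scalerBr scalerA mulVf// scale1r.
by rewrite invrZ ?unitfE ?invr_eq0// invrK.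
Qed.

Lemma dyadic_resolv_annulus_lip r1 r2 : 0 < r1 <= r2 -> r2 < d ->
  exists L : R, 0 <= L /\ forall k z w, r1 <= normc z <= r2 -> r1 <= normc w <= r2 ->
    bnorm (F k z - F k w) <= L * normc (z - w).
Proof.
move=> /andP[r10 r12] r2d.
have D0 z : r1 <= normc z <= r2 -> z != 0.
  by move=> /andP[h _]; rewrite -normc_gt0; apply: lt_le_trans h.
have DU z : r1 <= normc z <= r2 -> z%:A - a \is a GRing.unit.
  move=> /[dup] /D0 z0 /andP[_ h]; apply: aU.
  by rewrite normc_gt0 z0 (le_lt_trans h).
have [|K hK] := resolv_bounded (r1 := r1) _ DU; first by rewrite r10.
exists (bnorm a * (K * K)); split.
  by rewrite mulr_ge0 ?bnorm_ge0// -expr2 sqr_ge0.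
apply: (dyadic_resolv_lip D0 DU) => [z w w1|z w Dz Dw].
  by rewrite normcM w1 mul1r.
rewrite !dyadic_resolv0 ?D0 ?DU// opprD addrACA subrr add0r -mulrBr.
rewrite (resolvB (DU z Dz) (DU w Dw)) -scalerAr bnorm_scale mulrC.
rewrite -normcN opprB ler_wpM2r ?normc_ge0//.
rewrite (le_trans (bnormM_le _ _))// ler_wpM2l ?bnorm_ge0//.
by rewrite (le_trans (bnormM_le _ _))// ler_pM ?bnorm_ge0 ?hK.
Qed.

Lemma dyadic_resolv_cvg r : 0 < r < d -> exists p, bcvg (fun k => F k r%:C) p.
Proof.
move=> /andP[r0 rd].
have nr : normc r%:C = r by rewrite normc_real ?(ltW r0).
have [|L [L0 hL]] := @dyadic_resolv_annulus_lip r r _ rd; first by rewrite r0 lexx.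
have Dr : 0 < normc r%:C < d by rewrite nr r0.
apply: (@bcvg_geometric _ _ _ (L * r) (3 / 4)) => [|k]; first by apply/andP; lra.
have [x [xk x1]] := dyadic_root R k.
have nx := dyadic_root_norm xk.
rewrite (@dyadic_resolv_double _ _ a (fun z => 0 < normc z < d) _ aU _ _ _ x)//; first last.
- by move=> z w w1; rewrite normcM w1 mul1r.
- by move=> z /andP[]; rewrite normc_gt0.
set u := F k _; set v := F k _.
have -> : 2^-1 *: (u + v) - u = 2^-1 *: (v - u).
  rewrite -[X in _ - X]scale1r -{2}(mulVf (_ : 2 != 0 :> R[i])) ?pnatr_eq0//.
  by rewrite -scalerA -scalerBr scaler_nat mulr2n opprD addrACA subrr add0r.
rewrite bnorm_scale normcV -(rmorph_nat (real_complex R)) normc_real ?ler0n//.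
have := hL k (x * r%:C) r%:C; rewrite normcM nx mul1r nr lexx => /(_ isT isT).
have -> : x * r%:C - r%:C = (x - 1) * r%:C by rewrite mulrBl mul1r.
rewrite normcM nr -/u -/v => h.
rewrite mulrC ler_pdivrMr// (le_trans h)//.
rewrite [leRHS](_ : _ = L * (2 * (3 / 4) ^+ k * r)); last by ring.
by rewrite ler_wpM2l// ler_wpM2r// ltW.
Qed.

(** From here on [P r] is the Riesz projection attached to the circle of radius [r]. *)
Variable P : R -> B.
Hypothesis PE : forall r, 0 < r < d -> bcvg (fun k => F k r%:C) (P r).

Lemma riesz_comm x r : 0 < r < d -> GRing.comm x a -> GRing.comm x (P r).
Proof.
move=> rd xa.
have Fx k : x * F k r%:C = F k r%:C * x.
  apply/commrV/commrB; first exact: commr1.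
  by apply/commrX; rewrite /GRing.comm -scalerAl -scalerAr xa.
apply: (@bcvg_unique _ _ (fun k => x * F k r%:C)).
  by apply: bcvgM (PE rd); apply: bcvg_cst.
under eq_fun do rewrite Fx.
by apply: bcvgM; [apply: PE|apply: bcvg_cst].
Qed.

Lemma riesz_comm_a r : 0 < r < d -> GRing.comm (P r) a.
Proof. by move=> rd; apply/commr_sym/riesz_comm => //; apply: commr_refl. Qed.

Lemma riesz_dyadic_unit k r : 0 < r < d ->
  1 - (r%:C^-1 *: a) ^+ (2 ^ k) \is a GRing.unit.
Proof.
move=> /andP[r0 rd]; apply: (@dyadic_unit _ _ a (fun z => 0 < normc z < d)) => //.
- by move=> z /andP[]; rewrite normc_gt0.
- by move=> z w w1; rewrite normcM w1 mul1r.
- by rewrite normc_real ?(ltW r0) ?r0.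
Qed.

(** Up to a factor tending to 1, [F k r - F k s] is [F k r * (1 - F k s)]: the two
    inverted elements differ by the scalar [(s / r) ^+ (2 ^ k)] in front of the same
    power. *)
Lemma riesz_absorb s r : 0 < s -> s < r -> r < d -> P r * P s = P s.
Proof.
move=> s0 sr rd.
have r0 : 0 < r by apply: lt_trans sr.
have sD : 0 < s < d by rewrite s0 (lt_trans sr).
have rD : 0 < r < d by rewrite r0.
pose t k := (s / r) ^+ (2 ^ k).
have E k : F k r%:C - F k s%:C = (1 - (t k)%:C) *: (F k r%:C * (1 - F k s%:C)).
  have := riesz_dyadic_unit k sD; have := riesz_dyadic_unit k rD.
  rewrite /dyadic_resolv.
  have -> : (r%:C^-1 *: a) ^+ (2 ^ k) = (t k)%:C *: (s%:C^-1 *: a) ^+ (2 ^ k).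
    have s1 : s%:C != 0 by rewrite -normc_gt0 normc_real ?(ltW s0).
    rewrite /t rmorphXn -exprZn scalerA rmorphM/= fmorphV.
    by rewrite mulrAC divff// mul1r.
  set u := _ ^+ (2 ^ k); set V := 1 - _; set U := 1 - u => VU UU.
  have UV : U - V = (1 - (t k)%:C) *: (U - 1).
    rewrite /U /V opprB addrC addrA subrK addrAC subrr add0r scalerN.
    by rewrite scalerBl scale1r opprB.
  have -> : V^-1 * (1 - U^-1) = V^-1 * ((U - 1) * U^-1).
    by rewrite mulrBl mul1r divrr.
  rewrite scalerAr scalerAl -UV mulrBl divrr//.
  by rewrite mulrBr mulr1 mulrA mulVr// mul1r.
have t0 : bcvg (fun k => (1 - (t k)%:C) *: (F k r%:C * (1 - F k s%:C))) (P r * (1 - P s)).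
  set X := P r * (1 - P s).
  have hX : bcvg (fun k => F k r%:C * (1 - F k s%:C)) X.
    by apply: bcvgM; [apply: PE|apply: bcvgB; [apply: bcvg_cst|apply: PE]].
  rewrite -[X]subr0; under eq_fun do rewrite scalerBl scale1r.
  apply: bcvgB => //.
  have sr0 : 0 <= s / r by rewrite divr_ge0// ltW.
  have sr1 : s / r < 1 by rewrite ltr_pdivrMr ?mul1r.
  pose f k := (s / r) ^+ k * (bnorm (F k r%:C * (1 - F k s%:C) - X) + bnorm X).
  apply: (bcvg_squeeze (f := f)) => [k|]; last first.
    rewrite /f -(mul0r (0 + bnorm X)); apply: cvgM.
      by apply: cvg_expr; rewrite ger0_norm.
    by apply: cvgD => //; apply: cvg_cst.
  rewrite subr0 bnorm_scale normc_real ?exprn_ge0//.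
  rewrite ler_pM ?exprn_ge0 ?bnorm_ge0//.
    by rewrite /t ler_wiXn2l ?(ltW sr1)// ltnW// ltn_expl.
  by have := bnormD_le (F k r%:C * (1 - F k s%:C) - X) X; rewrite subrK.
have : P r - P s = P r * (1 - P s).
  apply: (@bcvg_unique _ _ (fun k => F k r%:C - F k s%:C)); first by apply: bcvgB; apply: PE.
  by under eq_fun do rewrite E.
by rewrite mulrBr mulr1 => /addrI/oppr_inj.
Qed.

Lemma riesz_lip r1 r2 : 0 < r1 <= r2 -> r2 < d -> exists L : R, 0 <= L /\
  forall s r, r1 <= s -> s <= r -> r <= r2 -> bnorm (P r - P s) <= L * (r - s).
Proof.
move=> r12 r2d; have [L [L0 hL]] := dyadic_resolv_annulus_lip r12 r2d.
move: r12 => /andP[r10 r12].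
exists L; split=> // s r r1s sr rr2.
have s0 : 0 < s by apply: lt_le_trans r1s.
have r0 : 0 < r by apply: lt_le_trans sr.
have rd : r < d by apply: le_lt_trans r2d.
apply: (@bcvg_le _ _ (fun k => F k r%:C - F k s%:C)); last first.
  by apply: bcvgB; apply: PE; rewrite ?r0 ?s0 ?(le_lt_trans sr).
move=> k; have := hL k r%:C s%:C.
rewrite -rmorphB !normc_real ?(ltW r0) ?(ltW s0) ?subr_ge0//.
by rewrite r1s rr2 (le_trans r1s)// (le_trans sr)//; apply.
Qed.

(** Let [s] tend to [r] from below in [P r * P s = P s]. *)
Lemma riesz_idem r : 0 < r < d -> P r * P r = P r.
Proof.
move=> /andP[r0 rd].
have r12 : 0 < r / 2 <= r by apply/andP; lra.
have [L [L0 hL]] := riesz_lip r12 rd.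
apply/eqP; rewrite -subr_eq0; apply/eqP/bnorm_le0/ler_addgt0Pl => e e0.
rewrite addr0; pose q := (bnorm (P r) + 1) * (L + 1).
have q0 : 0 < q by rewrite mulr_gt0// ltr_wpDl ?bnorm_ge0.
pose h := Num.min (r / 2) (e / q).
have h0 : 0 < h by rewrite lt_min !divr_gt0.
have hr : h <= r / 2 by rewrite ge_min lexx.
have he : q * h <= e by rewrite mulrC -ler_pdivlMr// ge_min lexx orbT.
have := hL (r - h) r _ _ (lexx r); rewrite subKr => /(_ ltac:(lra) ltac:(lra)) lip.
have rh := @riesz_absorb (r - h) r ltac:(lra) ltac:(lra) rd.
have -> : P r * P r - P r = P r * (P r - P (r - h)) - (P r - P (r - h)).
  by rewrite mulrBr rh opprB addrA subrK.
rewrite (le_trans (bnormB_le _ _))// (le_trans _ he)//.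
have := bnormM_le (P r) (P r - P (r - h)).
have := bnorm_ge0 (P r); rewrite /q; nra.
Qed.

(** [P r - P s] is an idempotent, hence zero as soon as its norm is below 1, which
    the Lipschitz bound grants for close radii. Larger gaps are bisected, by
    induction on the number [n] of bisections needed. *)
Lemma riesz_const s r : 0 < s -> s <= r -> r < d -> P s = P r.
Proof.
move=> s0 sr rd.
have r12 : 0 < s <= r by rewrite s0.
have [L [L0 hL]] := riesz_lip r12 rd.
suff H n x y : s <= x -> x <= y -> y <= r -> L * (y - x) < 2 ^+ n -> P x = P y.
  apply: (H (Num.bound (L * (r - s)))) => //.
  have := @archi_boundP R (L * (r - s)); rewrite mulr_ge0 ?subr_ge0// => /(_ isT).
  by move/lt_trans; apply; rewrite -natrX ltr_nat ltn_expl.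
elim: n x y => [|n IHn] x y sx xy yr.
  move: xy; rewrite le_eqVlt => /orP[/eqP-> //|xy] Lxy.
  have x0 : 0 < x by apply: lt_le_trans sx.
  have xd : 0 < x < d by rewrite x0 (lt_trans xy)// (le_lt_trans yr).
  have yd : 0 < y < d by rewrite (lt_trans x0)// (le_lt_trans yr).
  have yx := riesz_absorb x0 xy (le_lt_trans yr rd).
  have xyE : P x * P y = P x by rewrite (riesz_comm yd (riesz_comm_a xd)).
  set e := P y - P x.
  have ee : e * e = e.
    by rewrite /e mulrBl !mulrBr yx xyE !riesz_idem// subrr subr0.
  have e1 : bnorm e < 1 by apply: le_lt_trans (hL x y sx (ltW xy) yr) _.
  have e0 : bnorm e = 0.
    by have := bnormM_le e e; rewrite ee; have := bnorm_ge0 e; nra.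
  by apply/esym/eqP; rewrite -subr_eq0; apply/eqP/bnorm_eq0.
move=> Lxy.
have -> : P x = P ((x + y) / 2).
  by apply: IHn; move: Lxy; rewrite ?exprS; nra.
by apply: IHn; move: Lxy; rewrite ?exprS; nra.
Qed.

(** If the limit is 0 then some [F k r] has norm below 1; then [1 - F k r], which is
    [a] times an element commuting with it, is invertible by the Neumann series. *)
Lemma riesz_neq0 r : 0 < r < d -> a \isn't a GRing.unit -> P r <> 0.
Proof.
move=> rd aNU Pr0; have := PE rd; rewrite Pr0 => /(bcvg_small ltr01)[k].
rewrite subr0 => /bnorm_lt1_unit.
have := riesz_dyadic_unit k rd; rewrite /dyadic_resolv.
set u := _ ^+ _ => uU.
have -> : 1 - (1 - u)^-1 = - u * (1 - u)^-1.
  by apply: (mulIr uU); rewrite mulrBl -mulrA mulVr// mulr1 mul1r addrAC subrr add0r.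
have uC : GRing.comm (- u) (1 - u)^-1.
  by apply/commrV/commrB; [apply: commr1|apply/commr_sym/commrN/commr_refl].
rewrite unitrM_comm// unitrV uU andbT unitrN unitrX_pos ?expn_gt0//.
rewrite scaler_unit ?(negbTE aNU)// unitfE invr_eq0 -normc_gt0.
by case/andP: rd => r0 _; rewrite normc_real// ltW.
Qed.

(** With [u = (a / r) ^+ (2 ^ k)] and [e = F k r * p - p --> 0] one has
    [u * p = e - u * p * e], which forces [u * p] to be as small as [e]. *)
Lemma riesz_decay r : 0 < r < d -> exists N, (0 < N)%N /\ bnorm (a ^+ N * P r) <= r ^+ N.
Proof.
move=> rd; set p := P r.
have pp : p * p = p := riesz_idem rd.
have : bcvg (fun k => F k r%:C * p - p) (p * p - p).
  apply: bcvgB; last exact: bcvg_cst.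
  by apply: bcvgM; [exact: PE|exact: bcvg_cst].
rewrite pp subrr => /(bcvg_small (_ : 0 < 2^-1))[|k]; first by rewrite invr_gt0.
rewrite subr0 => hk; exists (2 ^ k)%N; split; first by rewrite expn_gt0.
have := riesz_dyadic_unit k rd.
have [r0 _] := andP rd.
have rC : r%:C != 0 by rewrite -normc_gt0 normc_real ?(ltW r0).
have aE : a ^+ (2 ^ k) * p = r%:C ^+ (2 ^ k) *: ((r%:C^-1 *: a) ^+ (2 ^ k) * p).
  by rewrite exprZn scalerAl scalerA exprVn mulfV ?expf_neq0// scale1r.
have pF : GRing.comm p (F k r%:C).
  apply/commrV/commrB; first exact: commr1.
  by apply/commrX; rewrite /GRing.comm -scalerAl -scalerAr (riesz_comm_a rd).
move: hk pF; rewrite aE /dyadic_resolv; set u := (r%:C^-1 *: a) ^+ _.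
set e := _ - p => he pF uU.
have upE : u * p = e - (u * p) * e.
  have pe : p * e = e by rewrite /e mulrBr mulrA pF -mulrA pp.
  rewrite -mulrA pe -{1}(mul1r e) -mulrBl /e mulrBr mulrA divrr//.
  by rewrite mul1r mulrBl mul1r opprB addrC subrK.
have up1 : bnorm (u * p) <= 1.
  have := bnormB_le e (u * p * e); rewrite -upE.
  by have := bnormM_le (u * p) e; have := bnorm_ge0 (u * p); nra.
rewrite bnorm_scale normcX normc_real ?(ltW r0)// ler_piMr//.
by rewrite exprn_ge0// ltW.
Qed.

End Riesz.

(** The decay of one power spreads to all of them by Euclidean division, since
    [a ^+ N * p] can be split off repeatedly when [p] is idempotent. *)
Lemma geometric_decay (R : realType) (B : banachAlgType R) (a p : B) (r : R) N :
  GRing.comm p a -> p * p = p -> 0 < r -> (0 < N)%N -> bnorm (a ^+ N * p) <= r ^+ N ->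
  exists C, forall k, bnorm (a ^+ k * p) <= C * r ^+ k.
Proof.
move=> pa pp r0 N0 aN.
pose f i := bnorm (a ^+ i * p) / r ^+ i.
have f0 i : 0 <= f i by rewrite mulr_ge0 ?bnorm_ge0 ?invr_ge0 ?exprn_ge0 ?(ltW r0).
exists (\sum_(i < N) f i) => k.
elim/ltn_ind: k => k IHk; have [kN|Nk] := ltnP k N.
  rewrite -ler_pdivrMr ?exprn_gt0// -/(f k) (bigD1 (Ordinal kN))//= lerDl.
  by apply: sumr_ge0 => i _.
rewrite (_ : a ^+ k * p = (a ^+ N * p) * (a ^+ (k - N) * p)).
  rewrite -{2}(subnKC Nk) exprD mulrCA (le_trans (bnormM_le _ _))//.
  rewrite ler_pM ?bnorm_ge0// IHk// ltn_subrL N0.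
  by apply: leq_trans Nk.
by rewrite -{1}(subnKC Nk) exprD -!mulrA (mulrA p) (commrX _ pa) -mulrA pp.
Qed.

(** Decay at rate [e] is read on the circle of radius [e]; independence of the radius
    makes one idempotent serve for all rates. *)
Theorem riesz_idempotent (R : realType) (B : banachAlgType R) (a : B) (d : R) :
  0 < d -> (forall z : R[i], 0 < normc z < d -> z%:A - a \is a GRing.unit) ->
  a \isn't a GRing.unit ->
  exists p : B, [/\ p * p = p, p <> 0 & forall e : R, 0 < e ->
    exists C, forall k, bnorm (a ^+ k * p) <= C * e ^+ k].
Proof.
move=> d0 aU aNU.
have [P PE] : exists P : R -> B, forall r, 0 < r < d ->
    bcvg (fun k => dyadic_resolv a k r%:C) (P r).
  suff /choice[P] : forall r, exists p, 0 < r < d -> bcvg (fun k => dyadic_resolv a k r%:C) p.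
    by exists P.
  move=> r; have [/(dyadic_resolv_cvg aU)[p hp]|h] := boolP (0 < r < d); first by exists p.
  by exists 0.
have hd : 0 < d / 2 < d by apply/andP; lra.
exists (P (d / 2)); split; [exact: riesz_idem PE _ hd|exact: riesz_neq0 PE _ hd aNU|].
move=> e e0; pose r := Num.min e (d / 2).
have r0 : 0 < r by rewrite lt_min e0; case/andP: hd.
have rd : r < d by rewrite gt_min; case/andP: hd => _ ->; rewrite orbT.
have rD : 0 < r < d by rewrite r0.
have <- : P r = P (d / 2).
  by apply: (riesz_const aU PE) => //; [rewrite ge_min lexx orbT|case/andP: hd].
have [N [N0 hN]] := riesz_decay aU PE rD.
have [C hC] := geometric_decay (riesz_comm_a PE rD) (riesz_idem aU PE rD) r0 N0 hN.
exists C => k; apply: le_trans (hC k) _.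
have C0 : 0 <= C by have := hC 0%N; rewrite expr0 mulr1; apply/le_trans/bnorm_ge0.
rewrite ler_wpM2l// lerXn2r ?nnegrE ?(ltW r0) ?(ltW e0)//.
by rewrite ge_min lexx.
Qed.

(** * The eigenprojection *)

Section Spectrum.
Variables (R : realType) (B : banachAlgType R) (b : B).
Hypothesis hb : doubly_power_bounded b.

Lemma doubly_power_boundedP : exists M : R, forall n : int, bnorm (b ^ n) <= M.
Proof. by case: hb => _ [M hM]; exists M => n; apply: hM; exists n. Qed.

(** Off the unit circle, [z - b] is inverted by the Neumann series of [z / b] or of
    [b / z]. *)
Lemma spectrum_unimodular z : spectrum b z -> normc z = 1.
Proof.
have [bU _] := hb; have [M hM] := doubly_power_boundedP.
move=> zb; apply/eqP; apply: contraPT zb => z1.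
rewrite /spectrum /=; apply/negP; rewrite negbK.
have [z_lt1|z_ge1] := ltP (normc z) 1.
  have -> : z%:A - b = - (b * (1 - z *: b^-1)).
    by rewrite mulrBr mulr1 -scalerAr divrr// opprB.
  rewrite unitrN unitrMr// (neumann_unit (A := M) (r := normc z)) ?normc_ge0// => n.
  rewrite exprZn bnorm_scale normcX mulrC ler_wpM2r ?exprn_ge0 ?normc_ge0//.
  by rewrite exprVn; have := hM (- n%:Z); rewrite -exprnN.
have {}z1 : 1 < normc z by rewrite lt_neqAle eq_sym z1.
have z0 : z != 0 by rewrite -normc_gt0 (lt_trans ltr01).
have -> : z%:A - b = z *: (1 - z^-1 *: b).
  by rewrite scalerBr scalerA mulfV// scale1r.
rewrite scaler_unit ?unitfE// (neumann_unit (A := M) (r := (normc z)^-1)).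
- by [].
- by rewrite invr_ge0 normc_ge0 invf_lt1 ?(lt_trans ltr01).
- move=> n; rewrite exprZn bnorm_scale normcX normcV mulrC.
  by rewrite ler_wpM2r ?exprn_ge0 ?invr_ge0 ?normc_ge0//; exact: (hM n%:Z).
Qed.

End Spectrum.

Lemma isolated_ball (R : realType) (A : set R[i]) (l : R[i]) :
  isolated (T := R[i]^o) A l ->
  A l /\ exists2 d : R, 0 < d & forall z, 0 < normc z < d -> ~ A (z + l).
Proof.
case=> /set_mem Al [V /nbhs_ballP[e e0 eV] VA]; split=> //.
(* The radius of a ball in [R[i]] is a positive complex number, hence real. *)
have eR : e = (complex.Re e)%:C by rewrite RRe_real// ger0_real// ltW.
exists (complex.Re e); first by move: e0; rewrite /= eR ltcR.
move=> z /andP[z0 zd] Az.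
have : [set l] (z + l).
  rewrite -VA; split=> //; apply: eV; rewrite /ball /= opprD addrC subrK normrN.
  by rewrite -normcC eR ltcR.
by move=> /= /eqP; rewrite -subr_eq0 addrK => /eqP zE; move: z0; rewrite zE normc0 ltxx.
Qed.

Theorem theorem3p1 (R : realType) (B : banachAlgType R) (b : B) (lambda : R[i])
    (hb : doubly_power_bounded b)
    (hl : isolated (T := R[i]^o) (spectrum b) lambda) :
  exists p : B, [/\ is_idempotent p, p <> 0 & b * p = lambda *: p].
Proof.
have [lb [d d0 hd]] := isolated_ball hl.
have l1 := spectrum_unimodular hb lb.
have l0 : lambda != 0 by rewrite -normc_gt0 l1.
have lV : normc lambda^-1 = 1 by rewrite normcV l1 invr1.
have [bU _] := hb; have [M hM] := doubly_power_boundedP hb.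
have [||p [pp p0 pq]] := @riesz_idempotent R B (b - lambda%:A) d d0.
- move=> z /hd; rewrite /spectrum /= scalerDl opprB addrA addrAC.
  by move/negP; rewrite negbK.
- by move: lb; rewrite /spectrum /= -opprB unitrN.
exists p; split=> //.
pose c := lambda^-1 *: b.
have cU : c \is a GRing.unit by rewrite scaler_unit ?unitfE ?invr_eq0.
have cn n : bnorm (c ^ n) <= M.
  have -> : c ^ n = (lambda^-1) ^ n *: b ^ n.
    case: n => n; rewrite ?NegzE -?exprnP -?exprnN exprZn//.
    by rewrite invrZ ?unitrX ?unitfE ?invr_eq0.
  rewrite bnorm_scale (_ : normc _ = 1) ?mul1r//.
  by case: n => n; rewrite ?NegzE -?exprnP -?exprnN ?normcV normcX lV expr1n ?invr1.
have cp : c * p = p.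
  apply: (local_gelfand cU cn) => e /pq[C hC]; exists C => k.
  have -> : c - 1 = lambda^-1 *: (b - lambda%:A).
    by rewrite scalerBr scalerA mulVf// scale1r.
  by rewrite exprZn -scalerAl bnorm_scale normcX lV expr1n mul1r.
by rewrite -{2}cp /c -scalerAl scalerA mulfV// scale1r.
Qed.
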